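(* Let $m,n\ge 1$. If $C$ is any maximal configuration on the $m\times n$ grid, then $|C|\le E_{m,n}\le R_{m,n}$, where for fixed $n$ the sequence $(R_{k,n})_{k\ge 0}$ is defined by $R_{0,n}=0$, $R_{1,n}=n$, and $$R_{k,n}=R_{k-1,n}+n-\left\lfloor\frac{R_{k-1,n}-R_{k-2,n}}{3}\right\rfloor\quad\text{for } k\ge 2.$$
   Context: The $m\times n$ grid is $[m]\times[n]=\{(i,j):1\le i\le m,\ 1\le j\le n\}$; $(i,j)$ is the lot in row $i$ and column $j$, rows counted from the north (row $m$ southernmost) and columns from the west. A configuration is a subset $C\subseteq[m]\times[n]$ (the occupied lots); $|C|$ is its occupancy. A house at $(i,j)\in C$ is blocked from sunlight if $(i,j+1)$, $(i,j-1)$, $(i+1,j)$ all lie in the grid and are all occupied (lots outside the grid never obstruct sunlight). A configuration is permissible if no house in it is blocked; it is maximal if it is permissible and no permissible configuration strictly contains it. $E_{m,n}$ denotes the maximum of $|C|$ over all maximal configurations $C$ on the $m\times n$ grid. *)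

(* Defs.v *)
(* Rows and columns are 0-based: row 0 is the northernmost and
   column 0 the westernmost. *)
From mathcomp Require Import all_boot all_order all_algebra.

Set Implicit Arguments.
Unset Strict Implicit.
Unset Printing Implicit Defensive.

Import GRing.Theory Num.Theory.

(* The neighbours are named by existential witnesses in C rather than computed,
   so a neighbour outside the grid never counts as occupied. *)
Definition east_occupied (m n : nat) (C : {set 'I_m * 'I_n}) (p : 'I_m * 'I_n) : bool :=
  [exists q in C, (q.1 == p.1 :> nat) && (q.2 == p.2.+1 :> nat)].

Definition west_occupied (m n : nat) (C : {set 'I_m * 'I_n}) (p : 'I_m * 'I_n) : bool :=
  [exists q in C, (q.1 == p.1 :> nat) && (q.2.+1 == p.2 :> nat)].

Definition south_occupied (m n : nat) (C : {set 'I_m * 'I_n}) (p : 'I_m * 'I_n) : bool :=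
  [exists q in C, (q.1 == p.1.+1 :> nat) && (q.2 == p.2 :> nat)].

Definition blocked (m n : nat) (C : {set 'I_m * 'I_n}) (p : 'I_m * 'I_n) : bool :=
  [&& p \in C, east_occupied C p, west_occupied C p & south_occupied C p].

Definition permissible (m n : nat) (C : {set 'I_m * 'I_n}) : bool :=
  [forall p in C, ~~ blocked C p].

Definition maximal_config (m n : nat) (C : {set 'I_m * 'I_n}) : bool :=
  maxset (@permissible m n) C.

Definition E (m n : nat) : nat :=
  \max_(C : {set 'I_m * 'I_n} | maximal_config C) #|C|.

(* Valued in int, so that both subtractions are the true ones; divz by 3 is the
   floor. *)
Fixpoint R (k n : nat) : int :=
  match k with
  | 0 => 0%:Z
  | 1 => n%:Z
  | (k'.+1 as k1).+1 => (R k1 n + n%:Z - ((R k1 n - R k' n) %/ 3)%Z)%R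
  end.

(* Main.v *)
Require Import Defs.
From mathcomp Require Import all_boot all_order all_algebra.
From mathcomp Require Import zify.

Set Implicit Arguments.
Unset Strict Implicit.
Unset Printing Implicit Defensive.

Import Order.TTheory GRing.Theory Num.Theory.

(** If a row has [b] houses and the row directly north of it has [g] empty lots,
    then each of the at least [b - 2] houses off the side edges is within
    horizontal distance 1 of the column of one of those [g] lots, so
    [b - 2 <= 3 g], that is, [g >= floor (b / 3)].  Writing [S k] for the number
    of houses in the [k] southernmost rows, this reads
    [S (k + 2) <= S (k + 1) + n - floor ((S (k + 1) - S k) / 3)].  The right-hand
    side is nondecreasing in both [S (k + 1)] and [S k], hence [S k <= R k n]. *)

Definition flanked (n : nat) (A : {set 'I_n}) : {set 'I_n} :=
  [set j in A | [exists w in A, w.+1 == j :> nat]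
             && [exists e in A, e == j.+1 :> nat]].

Lemma setC_flanked_sub (n : nat) (A : {set 'I_n.+1}) :
  ~: flanked A \subset
    ~: A :|: [set inord j.+1 | j : 'I_n.+1 in ~: A]
         :|: [set inord j.-1 | j : 'I_n.+1 in ~: A] :|: [set ord0; ord_max].
Proof.
apply/subsetP => j; rewrite inE; apply: contraR; rewrite !inE !negb_or negbK.
rewrite -!val_eqE /= => /andP[/andP[/andP[jA no_west_gap] no_east_gap]].
move=> /andP[j_gt0 j_neqn]; have j_ltn := ltn_ord j.
rewrite jA /=; apply/andP; split.
- have westE : (inord j.-1 : 'I_n.+1) = j.-1 :> nat by rewrite inordK //; lia.
  apply/exists_inP; exists (inord j.-1); last by rewrite westE; lia.
  apply: contraNT no_west_gap => gap; apply/imsetP.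
  exists (inord j.-1); first by rewrite inE.
  by rewrite westE prednK ?inord_val // lt0n.
- have eastE : (inord j.+1 : 'I_n.+1) = j.+1 :> nat by rewrite inordK //; lia.
  apply/exists_inP; exists (inord j.+1); last by rewrite eastE.
  apply: contraNT no_east_gap => gap; apply/imsetP.
  exists (inord j.+1); first by rewrite inE.
  by rewrite eastE inord_val.
Qed.

Lemma card_setC_flanked (n : nat) (A : {set 'I_n}) :
  #|~: flanked A| <= 3 * #|~: A| + 2.
Proof.
case: n A => [|n] A; first by rewrite (leq_trans (max_card _)) ?card_ord.
apply: leq_trans (subset_leq_card (setC_flanked_sub A)) _.
rewrite (leq_trans (leq_card_setU _ _)) // leq_add //; last first.
  by rewrite cards2; case: (_ == _).
rewrite !mulSn mul0n addn0 addnA.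
rewrite (leq_trans (leq_card_setU _ _)) // leq_add ?leq_imset_card //.
by rewrite (leq_trans (leq_card_setU _ _)) // leq_add ?leq_imset_card.
Qed.

Lemma card_disjoint_flanked (n : nat) (A B : {set 'I_n}) :
  [disjoint flanked A & B] -> #|A| + #|B| %/ 3 <= n.
Proof.
rewrite disjoint_sym disjoints_subset.
move=> /subset_leq_card B_le; have := leq_trans B_le (card_setC_flanked A).
by have := cardsC A; rewrite card_ord; lia.
Qed.

Section RowsFromSouth.

Variables (m n : nat) (C : {set 'I_m * 'I_n}).

(* The addition, unlike [m - k.+1], makes every row with [m <= k] empty. *)
Definition row_from_south (k : nat) : {set 'I_n} :=
  [set p.2 | p in C & p.1 + k.+1 == m].

Lemma mem_row_from_south (i : 'I_m) (j : 'I_n) (k : nat) :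
  i + k.+1 = m -> (j \in row_from_south k) = ((i, j) \in C).
Proof.
move=> ik; apply/imsetP/idP => [[[i' j'] + ->]|ijC]; last first.
  by exists (i, j); rewrite // inE ijC ik eqxx.
rewrite inE /= => /andP[ijC /eqP i'k].
by rewrite (_ : i = i') //; apply/val_inj/(@addIn k.+1); rewrite ik.
Qed.

Lemma card_row_from_south (k : 'I_m) :
  #|row_from_south k| = #|[set p in C | rev_ord p.1 == k]|.
Proof.
rewrite card_in_imset => [|[i j] [i' j']]; last first.
  rewrite !inE /= => /andP[_ /eqP ik] /andP[_ /eqP i'k] ->.
  by congr pair; apply/val_inj/(@addIn k.+1); rewrite ik.
apply: eq_card => -[i j]; rewrite !inE; congr andb.
by rewrite -val_eqE /=; have := ltn_ord i; lia.
Qed.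

Lemma sum_card_row_from_south : \sum_(k < m) #|row_from_south k| = #|C|.
Proof.
rewrite -sum1_card (partition_big (fun p => rev_ord p.1) xpredT) //=.
apply: eq_bigr => k _; rewrite card_row_from_south -sum1_card.
by apply: eq_bigl => p; rewrite inE.
Qed.

Lemma permissible_disjoint_flanked (k : nat) : permissible C ->
  [disjoint flanked (row_from_south k.+1) & row_from_south k].
Proof.
move=> /forall_inP unblocked; rewrite disjoints_subset; apply/subsetP => j.
rewrite !inE => /and3P[/imsetP[[i j'] + /= jj']]; rewrite -{j'}jj' inE /=.
move=> /andP[ijC /eqP ik] /exists_inP[w wA wj] /exists_inP[e eA ej].
have south_ltm : i.+1 < m by lia.
rewrite (mem_row_from_south _ (i := Ordinal south_ltm)) /=; last by lia.
apply: contra (unblocked _ ijC) => southC; rewrite /blocked ijC /=.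
apply/and3P; split; apply/exists_inP.
- by exists (i, e); rewrite /= ?eqxx // -(mem_row_from_south _ ik).
- by exists (i, w); rewrite /= ?eqxx // -(mem_row_from_south _ ik).
- by exists (Ordinal south_ltm, j); rewrite //= !eqxx.
Qed.

End RowsFromSouth.

Local Open Scope ring_scope.

Lemma lez_sub_divz (d x y x' y' : int) : 0 < d -> x <= x' -> y <= y' ->
  x - ((x - y) %/ d)%Z <= x' - ((x' - y') %/ d)%Z.
Proof.
move=> d_gt0 lexx' leyy'.
suff : ((x' - y') %/ d)%Z <= (x' - x) + ((x - y) %/ d)%Z by lia.
have dx_le : x' - x <= (x' - x) * d by rewrite ler_peMr ?subr_ge0.
rewrite -divzMDl ?lt0r_neq0 //; apply: lez_pdiv2r; first exact: ltW.
by lia.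
Qed.

Lemma ler_sum_R (n : nat) (a : nat -> nat) (k : nat) :
  (a 0 <= n)%N -> (forall i, (a i.+1 + a i %/ 3 <= n)%N) ->
  (\sum_(i < k) a i)%N%:Z <= R k n.
Proof.
move=> a0_le aS_le; elim/ltn_ind: k => -[|[|k]] IH.
- by rewrite big_ord0.
- by rewrite big_ord1.
pose S i := (\sum_(j < i) a j)%N.
have SS i : S i.+1 = (S i + a i)%N by rewrite /S big_ord_recr.
rewrite [R _ n]/= -/(R k.+1 n) addrAC.
have := lez_sub_divz (d := 3) isT (IH k.+1 (leqnn _)) (IH k (leqnSn _)).
by rewrite -/(S k) -/(S k.+1) -/(S k.+2) !SS; have := aS_le k; lia.
Qed.

Lemma permissible_card_le_R (m n : nat) (C : {set 'I_m * 'I_n}) :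
  permissible C -> #|C|%:Z <= R m n.
Proof.
move=> permC; rewrite -sum_card_row_from_south.
apply: (ler_sum_R (a := fun k => #|row_from_south C k|)) => [|k].
  by rewrite -[X in (_ <= X)%N]card_ord max_card.
exact/card_disjoint_flanked/permissible_disjoint_flanked.
Qed.

Theorem theorem4p12 (m n : nat) (hm : (1 <= m)%N) (hn : (1 <= n)%N)
    (C : {set 'I_m * 'I_n}) (hC : maximal_config C) :
  (#|C| <= E m n)%N /\ ((E m n)%:Z <= R m n)%R.
Proof.
split; first exact: leq_bigmax_cond.
have some_maximal : (0 < #|@maximal_config m n|)%N by apply/card_gt0P; exists C.
rewrite /E; have [D maxD ->] :=
  eq_bigmax_cond (fun D : {set 'I_m * 'I_n} => #|D|) some_maximal.
exact/permissible_card_le_R/(maxsetp maxD).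
Qed.
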